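(* Let $X$ be a real Banach space, $Y$ a closed linear subspace of $X$, and let $\mathcal{A}(Y)$ be one of the families $\mathcal{F}(Y)$, $\mathcal{K}(Y)$, $\mathcal{B}(Y)$ of nonempty finite, nonempty compact, nonempty closed bounded subsets of $Y$, respectively. Suppose that for all $F\in\mathcal{A}(Y)$ and all continuous monotone $f:\ell_\infty(F)\to\mathbb{R}_{\ge0}$, $\mathrm{rad}_Y^f(F)=\mathrm{rad}_X^f(F)$ and $X$ admits $f$-centers for $F$. Then the following are equivalent: (a) $Y$ is an $\mathcal{A}(Y)$-$C$-subspace of $X$. (b) The triplet $(X,Y,\mathcal{A}(Y))$ has the restricted weighted Chebyshev center property. (c) $\mathrm{Cent}_Y^f(F)=\mathrm{Cent}_X^f(F)\cap Y\neq\emptyset$ for all $F\in\mathcal{A}(Y)$ and each continuous, monotone $f:\ell_\infty(F)\to\mathbb{R}_{\ge0}$.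
   Context: Sets are regarded as indexed by themselves; a finite set may be regarded as an ordered tuple with repetitions allowed, in which case $\ell_\infty(F)=\mathbb{R}^n_{\ge 0}$. $\ell_\infty(F)=\{\varphi:F\to\mathbb{R}_{\ge0}:\sup_{t\in F}\varphi(t)<\infty\}$ with the supremum norm and the pointwise order. A function $f:\ell_\infty(F)\to\mathbb{R}_{\ge0}$ is monotone if $\varphi_1\le\varphi_2$ implies $f(\varphi_1)\le f(\varphi_2)$. For $x\in X$ and a subspace $Z\subseteq X$ (in particular $Z=Y$ or $Z=X$): $r_f(x,F)=f\big((\|x-a\|)_{a\in F}\big)$, $\mathrm{rad}_Z^f(F)=\inf_{z\in Z}r_f(z,F)$, $\mathrm{Cent}_Z^f(F)=\{z\in Z: r_f(z,F)=\mathrm{rad}_Z^f(F)\}$. $X$ admits $f$-centers for $F$ if $\mathrm{Cent}_X^f(F)\ne\emptyset$. The triplet $(X,Y,\mathfrak{F})$, with $\mathfrak F$ a family of closed bounded subsets of $X$, has the restricted weighted Chebyshev center property if for all $F\in\mathfrak{F}$ and all bounded weights $\rho:F\to\mathbb{R}_{\ge0}$ one has $\mathrm{Cent}_Y^f(F)\ne\emptyset$ for $f(\varphi)=\sup_{t\in F}\rho(t)\varphi(t)$. For a family $\mathcal{S}$ of subsets of $Y$, $Y$ is an $\mathcal{S}$-$C$-subspace of $X$ if for all $x\in X$ and $A\in\mathcal{S}$ there is $y\in Y$ with $\|y-a\|\le\|x-a\|$ for all $a\in A$. *)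

(* Defs.v *)
From HB Require Import structures.
From mathcomp Require Import all_boot all_order all_algebra.
From mathcomp Require Import all_classical all_reals all_analysis.

Set Implicit Arguments.
Unset Strict Implicit.
Unset Printing Implicit Defensive.

Import Order.TTheory GRing.Theory Num.Theory.
Import numFieldNormedType.Exports.

Local Open Scope classical_set_scope.
Local Open Scope ring_scope.

Definition closed_subspace (R : realType) (X : normedModType R) (Y : set X) :
    Prop :=
  closed Y /\ GRing.submod_closed (mem Y).

(* The index type [T] is meant to be a set [F : set X] coerced to the type of
   its elements, so that sets are indexed by themselves. *)
Definition linfty (R : realType) (T : Type) : set (T -> R) :=
  [set phi | (forall t, 0 <= phi t) /\ has_ubound (range phi)].
Arguments linfty : clear implicits.

(* Here and in [weighted_sup] below, [sup] is the genuine supremum, the range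
   being bounded whenever the functions involved are, and [T] nonempty. *)
Definition sup_norm (R : realType) (T : Type) (phi : T -> R) : R :=
  sup (range (fun t => `|phi t|)).

(* A function from [linfty R T] to the nonnegative reals is represented by a
   total [f : (T -> R) -> R] that is only ever constrained and evaluated on
   [linfty R T]; its values elsewhere are irrelevant. *)
Definition nonneg_valued (R : realType) (T : Type) (f : (T -> R) -> R) : Prop :=
  forall phi, linfty R T phi -> 0 <= f phi.

Definition monotone_fun (R : realType) (T : Type) (f : (T -> R) -> R) : Prop :=
  forall phi1 phi2, linfty R T phi1 -> linfty R T phi2 ->
    (forall t, phi1 t <= phi2 t) -> f phi1 <= f phi2.

Definition norm_continuous (R : realType) (T : Type) (f : (T -> R) -> R) :
    Prop :=
  forall phi, linfty R T phi -> forall e, 0 < e ->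
    exists2 d, 0 < d & forall psi, linfty R T psi ->
      sup_norm (psi \- phi) < d -> `|f psi - f phi| < e.

Definition cont_monotone (R : realType) (T : Type) (f : (T -> R) -> R) : Prop :=
  [/\ nonneg_valued f, norm_continuous f & monotone_fun f].

Definition r_dist (R : realType) (X : normedModType R) (F : set X)
    (f : (F -> R) -> R) (x : X) : R :=
  f (fun a : F => `|x - \val a|).

(* Used for nonempty [Z], bounded [F] and nonnegative [f], in which case the
   real infimum is the genuine one. *)
Definition restricted_radius (R : realType) (X : normedModType R) (Z : set X)
    (F : set X) (f : (F -> R) -> R) : R :=
  inf [set r_dist f z | z in Z].

Definition centers (R : realType) (X : normedModType R) (Z : set X) (F : set X)
    (f : (F -> R) -> R) : set X :=
  [set z | Z z /\ r_dist f z = restricted_radius Z f].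

Definition admits_centers (R : realType) (X : normedModType R) (F : set X)
    (f : (F -> R) -> R) : Prop :=
  centers [set: X] f !=set0.

Definition weighted_sup (R : realType) (T : Type) (rho : T -> R)
    (phi : T -> R) : R :=
  sup (range (fun t => rho t * phi t)).

Definition restricted_weighted_Chebyshev_center_property (R : realType)
    (X : normedModType R) (Y : set X) (FF : set (set X)) : Prop :=
  forall F : set X, FF F -> forall rho : F -> R, linfty R F rho ->
    centers Y (weighted_sup rho) !=set0.

Definition C_subspace (R : realType) (X : normedModType R) (S : set (set X))
    (Y : set X) : Prop :=
  forall (x : X) (A : set X), S A ->
    exists2 y, Y y & forall a, A a -> `|y - a| <= `|x - a|.

Inductive family_kind := Finite_sets | Compact_sets | Closed_bounded_sets.

(* For closed [Y], a subset of [Y] is closed (resp. compact) in [Y] if and only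
   if it is so in [X]. *)
Definition subset_family (R : realType) (X : normedModType R) (k : family_kind)
    (Y : set X) : set (set X) :=
  [set F | [/\ F !=set0, F `<=` Y &
    match k with
    | Finite_sets => finite_set F
    | Compact_sets => compact F
    | Closed_bounded_sets => closed F /\ bounded_set F
    end]].

(* Main.v *)
Require Import Defs.
From HB Require Import structures.
From mathcomp Require Import all_boot all_order all_algebra.
From mathcomp Require Import all_classical all_reals all_analysis.

Set Implicit Arguments.
Unset Strict Implicit.
Unset Printing Implicit Defensive.

Import Order.TTheory GRing.Theory Num.Theory.
Import numFieldNormedType.Exports.

Local Open Scope classical_set_scope.
Local Open Scope ring_scope.

(** The proof goes round the cycle C-subspace, centers of all continuous
    monotone functions, centers of weighted suprema, C-subspace.

    If [Y] is a C-subspace and [x] is an f-center of [F] in [X], a point [y] of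
    [Y] that is at least as close as [x] to every point of [F] satisfies
    [r_dist f y <= r_dist f x] by monotonicity, so [y] is an f-center in [X] as
    well; and as the two radii agree, the f-centers in [Y] are exactly the
    f-centers in [X] that lie in [Y] ([centers_of_C_subspace]).

    Since weighted suprema are continuous and monotone
    ([weighted_sup_cont_monotone]), the existence of weighted centers is a
    special case.

    The return to the C-subspace property is where the weights are chosen.  For
    [x] outside [Y], the weight [rho a = 1 / |x - a|] is bounded because [Y] is
    closed, and it makes the weighted radius of [F] seen from [x] at most [1].
    The radius over [Y] equals that over [X], so it is at most [1] too, and a
    weighted center [y] in [Y] satisfies [|y - a| / |x - a| <= 1] for every [a]
    in [F] ([C_subspace_of_weighted_centers]). *)

Section WeightedSup.
Variables (R : realType) (T : Type).
Implicit Types (rho phi psi : T -> R) (t : T).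

Lemma has_ubound_rangeP phi :
  has_ubound (range phi) <-> exists M, forall t, phi t <= M.
Proof.
split=> -[M hM]; exists M; first by move=> t; apply: hM; exists t.
by move=> _ [t _ <-]; apply: hM.
Qed.

Lemma linfty_mul rho phi :
  linfty R T rho -> linfty R T phi -> linfty R T (fun t => rho t * phi t).
Proof.
move=> [rho0 /has_ubound_rangeP[K hK]] [phi0 /has_ubound_rangeP[M hM]].
split=> [t|]; first exact: mulr_ge0.
by apply/has_ubound_rangeP; exists (K * M) => t; apply: ler_pM.
Qed.

Lemma ler_weighted_sup rho phi t : linfty R T rho -> linfty R T phi ->
  rho t * phi t <= weighted_sup rho phi.
Proof.
move=> hrho hphi; apply: ub_le_sup; last by exists t.
by case: (linfty_mul hrho hphi).
Qed.

Lemma weighted_sup_ler rho phi M (t0 : T) :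
  (forall t, rho t * phi t <= M) -> weighted_sup rho phi <= M.
Proof.
move=> hM; apply: ge_sup; first by exists (rho t0 * phi t0), t0.
by move=> _ [t _ <-].
Qed.

Lemma ler_sup_normB phi psi t : linfty R T phi -> linfty R T psi ->
  `|psi t - phi t| <= sup_norm (psi \- phi).
Proof.
move=> [phi0 /has_ubound_rangeP[M hM]] [psi0 /has_ubound_rangeP[N hN]].
apply: ub_le_sup; last by exists t.
apply/has_ubound_rangeP; exists (N + M) => s /=.
by rewrite (le_trans (ler_normB _ _))// !ger0_norm// lerD.
Qed.

Lemma sup_normB phi psi : sup_norm (psi \- phi) = sup_norm (phi \- psi).
Proof.
by rewrite /sup_norm; under eq_fun do rewrite /= distrC.
Qed.

(** Bounding [rho t * psi t] by [rho t * phi t] plus [K] times the distance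
    from [phi] to [psi] at each [t] gives one half of the Lipschitz estimate;
    exchanging [phi] and [psi] gives the other. *)
Lemma weighted_sup_lipschitz rho phi psi K (t0 : T) :
  linfty R T rho -> linfty R T phi -> linfty R T psi ->
  (forall t, rho t <= K) ->
  weighted_sup rho psi <= weighted_sup rho phi + K * sup_norm (psi \- phi).
Proof.
move=> hrho hphi hpsi hK; apply: (weighted_sup_ler t0) => t.
rewrite -[psi t](subrK (phi t)) addrC mulrDr lerD ?ler_weighted_sup//.
have rho0 : 0 <= rho t by case: hrho.
apply: (@le_trans _ _ (rho t * `|psi t - phi t|)).
  by rewrite ler_wpM2l// ler_norm.
by rewrite ler_pM ?ler_sup_normB.
Qed.

Lemma weighted_sup_cont_monotone rho (t0 : T) :
  linfty R T rho -> cont_monotone (weighted_sup rho).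
Proof.
move=> hrho; have [rho0 /has_ubound_rangeP[M hM]] := hrho.
split.
- move=> phi hphi; apply: le_trans (ler_weighted_sup t0 hrho hphi).
  by rewrite mulr_ge0//; case: hphi.
- (* [M] may vanish, whereas the modulus [e / K] needs a positive bound [K]. *)
  pose K := M + 1.
  have K0 : 0 < K by rewrite ltr_pwDr// (le_trans (rho0 t0)).
  have hK t : rho t <= K by rewrite (le_trans (hM t))// lerDl.
  move=> phi hphi e e0; exists (e / K); first exact: divr_gt0.
  move=> psi hpsi; rewrite ltr_pdivlMr// mulrC; apply: le_lt_trans.
  rewrite ler_norml lerBlDl weighted_sup_lipschitz// andbT.
  by rewrite lerNl opprB lerBlDl sup_normB weighted_sup_lipschitz.
- move=> phi psi hphi hpsi le_phi; apply: (weighted_sup_ler t0) => t.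
  by apply: le_trans (ler_weighted_sup t hrho hpsi); rewrite ler_wpM2l.
Qed.

End WeightedSup.

Section Distances.
Variables (R : realType) (X : normedModType R).
Implicit Types (Y Z F : set X) (k : family_kind).

Lemma subset_family_bounded k Y F : subset_family k Y F -> bounded_set F.
Proof.
case: k => -[_ _]; last by case.
- by move=> /finite_compact /compact_bounded.
- exact: compact_bounded.
Qed.

Lemma linfty_dist F x :
  bounded_set F -> linfty R F (fun a : F => `|x - \val a|).
Proof.
move=> [M [_ hM]]; split=> //.
apply/has_ubound_rangeP; exists (`|x| + (M + 1)) => a.
rewrite (le_trans (ler_normB _ _))// lerD2l.
by apply: (hM (M + 1)); [rewrite ltrDl|exact: set_valP].
Qed.

Lemma restricted_radius_le Z F (f : (F -> R) -> R) z : bounded_set F ->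
  nonneg_valued f -> Z z -> restricted_radius Z f <= r_dist f z.
Proof.
move=> bF f0 Zz; apply: ge_inf; last by exists z.
by exists 0 => _ [y _ <-]; apply: f0; apply: linfty_dist.
Qed.

(** A ball around [x] inside the open complement of [Y] keeps every point of [Y]
    at least its radius away from [x]; this bounds the weights [1 / |x - a|]. *)
Lemma closed_distance_gt0 Y x : closed Y -> ~ Y x ->
  exists2 e, 0 < e & forall y, Y y -> e <= `|x - y|.
Proof.
move=> cY nYx; have : nbhs x (~` Y).
  by apply: open_nbhs_nbhs; split=> //; apply: closed_openC.
move=> /nbhs_ballP[e /= e0 sub]; exists e => // y Yy.
by rewrite leNgt; apply/negP => xy; apply: (sub y) => //; rewrite -ball_normE.
Qed.

(** By monotonicity, moving an f-center of [F] into [Y] without increasing any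
    distance to [F] leaves the value of [f] minimal: this gives the nonemptiness.  The equality of the two sets is the
    equality of the radii. *)
Lemma centers_of_C_subspace (S : set (set X)) Y F (f : (F -> R) -> R) :
  C_subspace S Y -> S F -> bounded_set F -> cont_monotone f ->
  restricted_radius Y f = restricted_radius [set: X] f -> admits_centers f ->
  centers Y f = centers [set: X] f `&` Y /\ centers [set: X] f `&` Y !=set0.
Proof.
move=> CY SF bF [f0 _ fmono] eqrad [x [_ xrad]]; split.
  apply/seteqP; split=> z; rewrite /centers /= eqrad; first by case.
  by case=> -[].
have [y Yy hy] := CY x F SF; exists y; split=> //; split=> //.
apply/eqP; rewrite eq_le restricted_radius_le// andbT -xrad.
by apply: fmono => [||a]; [exact: linfty_dist..|apply: hy; apply: set_valP].
Qed.

(** With the weights [1 / |x - a|], the closed ball of radius [1] for the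
    weighted distance consists of the points that are at least as close as [x]
    to every [a] in [F].  It contains [x], so the equality of the radii forces
    every weighted center in [Y] to lie in it.  A point [x] of [Y], where a
    weight could be infinite, is its own witness. *)
Lemma C_subspace_of_weighted_centers (S : set (set X)) Y : closed Y ->
  (forall F, S F -> [/\ F !=set0, F `<=` Y & bounded_set F]) ->
  (forall F, S F -> forall rho : F -> R, linfty R F rho ->
    restricted_radius Y (weighted_sup rho) =
    restricted_radius [set: X] (weighted_sup rho)) ->
  restricted_weighted_Chebyshev_center_property Y S -> C_subspace S Y.
Proof.
move=> cY hS eqrad hcent x F SF.
have [Yx|nYx] := pselect (Y x); first by exists x.
have [[a0 Fa0] FY bF] := hS F SF.
pose t0 : F := SigSub (mem_set Fa0).
have [e e0 he] := closed_distance_gt0 cY nYx.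
have he' (a : F) : e <= `|x - \val a| by apply/he/FY/set_valP.
have dist0 (a : F) : 0 < `|x - \val a| by apply: lt_le_trans (he' a).
pose rho := fun a : F => `|x - \val a|^-1.
have hrho : linfty R F rho.
  split=> [a|]; first by rewrite invr_ge0.
  by apply/has_ubound_rangeP; exists e^-1 => a; rewrite lef_pV2 ?posrE.
have [y [Yy ycent]] := hcent F SF rho hrho; exists y => // a Fa.
pose t : F := SigSub (mem_set Fa).
have y1 : weighted_sup rho (fun b : F => `|y - \val b|) <= 1.
  have -> : weighted_sup rho (fun b : F => `|y - \val b|) =
      restricted_radius [set: X] (weighted_sup rho) by rewrite -eqrad.
  have [f0 _ _] := weighted_sup_cont_monotone t0 hrho.
  apply: (le_trans (@restricted_radius_le _ _ _ x bF f0 I)).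
  by apply: (weighted_sup_ler t0) => b; rewrite mulVf// gt_eqF.
have := le_trans (ler_weighted_sup t hrho (linfty_dist y bF)) y1.
by rewrite /rho mulrC ler_pdivrMr ?dist0// mul1r.
Qed.

End Distances.

Theorem theorem2p3 (R : realType) (X : completeNormedModType R) (Y : set X)
    (hY : closed_subspace Y) (k : family_kind)
    (hrad : forall F : set X, subset_family k Y F ->
       forall f : (F -> R) -> R, cont_monotone f ->
         restricted_radius Y f = restricted_radius [set: X] f /\ admits_centers f) :
  [<-> C_subspace (subset_family k Y) Y;
       restricted_weighted_Chebyshev_center_property Y (subset_family k Y);
       forall F : set X, subset_family k Y F ->
         forall f : (F -> R) -> R, cont_monotone f ->
           centers Y f = centers [set: X] f `&` Y /\
           centers [set: X] f `&` Y !=set0].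
Proof.
have C_centers : C_subspace (subset_family k Y) Y ->
    forall F : set X, subset_family k Y F ->
    forall f : (F -> R) -> R, cont_monotone f ->
      centers Y f = centers [set: X] f `&` Y /\
      centers [set: X] f `&` Y !=set0.
  move=> CY F kF f cmf; have [eqrad adm] := hrad F kF f cmf.
  exact: (centers_of_C_subspace CY kF (subset_family_bounded kF)).
have weighted (F : set X) : subset_family k Y F ->
    forall rho : F -> R, linfty R F rho -> cont_monotone (weighted_sup rho).
  by case=> -[a Fa] _ _ rho; apply/weighted_sup_cont_monotone/(SigSub (mem_set Fa)).
have centers_weighted : (forall F : set X, subset_family k Y F ->
    forall f : (F -> R) -> R, cont_monotone f ->
      centers Y f = centers [set: X] f `&` Y /\
      centers [set: X] f `&` Y !=set0) ->
    restricted_weighted_Chebyshev_center_property Y (subset_family k Y).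
  by move=> hc F kF rho hrho; have [->] := hc F kF _ (weighted F kF rho hrho).
have weighted_C :
    restricted_weighted_Chebyshev_center_property Y (subset_family k Y) ->
    C_subspace (subset_family k Y) Y.
  apply: C_subspace_of_weighted_centers; first by case: hY.
  - by move=> F kF; have bF := subset_family_bounded kF; case: kF.
  - by move=> F kF rho hrho; have [] := hrad F kF _ (weighted F kF rho hrho).
tfae=> [/C_centers/centers_weighted|/weighted_C/C_centers|
       /centers_weighted/weighted_C] //.
Qed.
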